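(* Let $P$ be a nearly reversible irreducible row-stochastic $n\times n$ matrix ($n\ge2$) with Poincaré constant $\mu$. Let $\gamma^\star$ be either $$\gamma^\star_\infty=\frac{\sqrt n\,\eta_\infty}{1-\sqrt n\,\eta_\infty}\qquad\text{or}\qquad\gamma^\star_2=\frac{\eta_2}{1-\eta_2}.$$ Let $\beta_{\mathrm{norm}}\in(0,1]$ satisfy $\gamma^\star\le\sqrt{\beta_{\mathrm{norm}}}$, and let the RLGL iterates $x_{t+1}=x_t-x_t(I-P)I_{\{i_t\}}$, with $y_t=x_t\Pi^{-1/2}$, use an update schedule $(i_t)_{t\ge0}$ such that $i_t$ is $\beta_{\mathrm{norm}}$-good at $y_t$ for every $t$. If $$\eta_\infty^2<\tilde\beta:=\left(\frac{\sqrt{\beta_{\mathrm{norm}}}-\gamma^\star}{1+\gamma^\star}\right)^2,$$ then the RLGL algorithm converges exponentially, with rate at least $-\log\big(1-\tilde\beta\mu+\frac{\kappa^2}{\mu}\big)$, i.e. $1-\tilde\beta\mu+\frac{\kappa^2}{\mu}<1$ and $$\mathcal{E}(y_t)\le\Big(1-\tilde\beta\mu+\frac{\kappa^2}{\mu}\Big)^t\mathcal{E}(y_0)\qquad\text{for all }t\ge0.$$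
   Context: Vectors are row vectors; $I_{\{i\}}$ is the diagonal matrix with a single $1$ in position $i$. $\pi$ is the unique positive probability row vector with $\pi P=\pi$; $\Pi=\mathrm{diag}(\pi)$; $P^*=\Pi^{-1}P^\top\Pi$. Set $S=\tfrac12\Pi^{1/2}(P+P^* )\Pi^{-1/2}$ (symmetric), $A=\tfrac12\Pi^{1/2}(P-P^* )\Pi^{-1/2}$ (antisymmetric), $\mathcal{L}=I-S$ (symmetrized Laplacian, positive semidefinite), and $\mathcal{L}_{\mathrm{norm}}=I-\Pi^{1/2}P\Pi^{-1/2}=\mathcal{L}-A$. The Poincaré constant $\mu$ is the smallest nonzero eigenvalue of $\mathcal{L}$. The Dirichlet energy is $\mathcal{E}(y)=\tfrac12y\mathcal{L}y^\top$. Irreversibility coefficients: $\kappa_i=\|A_{i,:}\|_2$ (Euclidean norm of the $i$-th row of $A$), $\kappa=\max_i\kappa_i$, $\eta_\infty=\kappa/\mu$, $\eta_2=\frac1\mu\big(\sum_{i=1}^n\kappa_i^2\big)^{1/2}$. $P$ is nearly reversible if $\eta_\infty<\frac{1}{2n+\sqrt n}$. A coordinate $i$ is $\beta_{\mathrm{norm}}$-good at $y$ if, with $r=y\mathcal{L}_{\mathrm{norm}}$, $|r_i|^2\ge\beta_{\mathrm{norm}}\|r\|_2^2$. *)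

(* Defs.v *)
From mathcomp Require Import all_boot all_order all_algebra.
From mathcomp Require Import reals.

Set Implicit Arguments.
Unset Strict Implicit.
Unset Printing Implicit Defensive.

Import Order.TTheory GRing.Theory Num.Theory.
Local Open Scope ring_scope.

(* Euclidean norm; the canonical norm of MathComp-Analysis on matrices is the
   sup norm. *)
Definition norm2 (R : realType) (n : nat) (v : 'rV[R]_n) : R :=
  Num.sqrt (\sum_(j < n) v 0 j ^+ 2).

Definition row_stochastic (R : realType) (n : nat) (P : 'M[R]_n) : Prop :=
  (forall i j, 0 <= P i j) /\ (forall i, \sum_(j < n) P i j = 1).

(* [^+] is the power for the matrix product. The value k = 0 only matters for
   i = j; for P >= 0 and n >= 2 requiring k > 0 would be equivalent. *)
Definition irreducible (R : realType) (n : nat) (P : 'M[R]_n) : Prop :=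
  forall i j : 'I_n, exists k : nat, 0 < (P ^+ k) i j.

Definition stationary (R : realType) (n : nat) (P : 'M[R]_n) (pi : 'rV[R]_n) :
    Prop :=
  [/\ forall j, 0 < pi 0 j, \sum_(j < n) pi 0 j = 1 & pi *m P = pi].

Definition sqrt_diag (R : realType) (n : nat) (pi : 'rV[R]_n) : 'M[R]_n :=
  diag_mx (map_mx Num.sqrt pi).

(* The time reversal P^* of P with respect to pi. *)
Definition reversal (R : realType) (n : nat) (P : 'M[R]_n) (pi : 'rV[R]_n) :
    'M[R]_n :=
  invmx (diag_mx pi) *m P^T *m diag_mx pi.

Definition sym_part (R : realType) (n : nat) (P : 'M[R]_n) (pi : 'rV[R]_n) :
    'M[R]_n :=
  2^-1 *: (sqrt_diag pi *m (P + reversal P pi) *m invmx (sqrt_diag pi)).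

Definition antisym_part (R : realType) (n : nat) (P : 'M[R]_n)
    (pi : 'rV[R]_n) : 'M[R]_n :=
  2^-1 *: (sqrt_diag pi *m (P - reversal P pi) *m invmx (sqrt_diag pi)).

Definition laplacian (R : realType) (n : nat) (P : 'M[R]_n) (pi : 'rV[R]_n) :
    'M[R]_n :=
  1%:M - sym_part P pi.

Definition laplacian_norm (R : realType) (n : nat) (P : 'M[R]_n)
    (pi : 'rV[R]_n) : 'M[R]_n :=
  1%:M - sqrt_diag pi *m P *m invmx (sqrt_diag pi).

(* An eigenvalue has a nonzero row eigenvector: [v *m L = mu *: v]. *)
Definition poincare_constant (R : realType) (n : nat) (P : 'M[R]_n)
    (pi : 'rV[R]_n) (mu : R) : Prop :=
  [/\ eigenvalue (laplacian P pi) mu, mu != 0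
    & forall a, eigenvalue (laplacian P pi) a -> a != 0 -> mu <= a].

Definition dirichlet (R : realType) (n : nat) (P : 'M[R]_n) (pi : 'rV[R]_n)
    (y : 'rV[R]_n) : R :=
  2^-1 * (y *m laplacian P pi *m y^T) 0 0.

Definition kappa_row (R : realType) (n : nat) (P : 'M[R]_n) (pi : 'rV[R]_n)
    (i : 'I_n) : R :=
  norm2 (row i (antisym_part P pi)).

(* The default value 0 of the maximum is harmless: [kappa_row] is
   nonnegative. *)
Definition kappa (R : realType) (n : nat) (P : 'M[R]_n) (pi : 'rV[R]_n) : R :=
  \big[Num.max/0]_(i < n) kappa_row P pi i.

Definition eta_inf (R : realType) (n : nat) (P : 'M[R]_n) (pi : 'rV[R]_n)
    (mu : R) : R :=
  kappa P pi / mu.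

Definition eta_2 (R : realType) (n : nat) (P : 'M[R]_n) (pi : 'rV[R]_n)
    (mu : R) : R :=
  mu^-1 * Num.sqrt (\sum_(i < n) kappa_row P pi i ^+ 2).

Definition nearly_reversible (R : realType) (n : nat) (P : 'M[R]_n)
    (pi : 'rV[R]_n) (mu : R) : Prop :=
  eta_inf P pi mu < 1 / (2 * n%:R + Num.sqrt n%:R).

Definition gamma_inf (R : realType) (n : nat) (P : 'M[R]_n) (pi : 'rV[R]_n)
    (mu : R) : R :=
  Num.sqrt n%:R * eta_inf P pi mu / (1 - Num.sqrt n%:R * eta_inf P pi mu).

Definition gamma_2 (R : realType) (n : nat) (P : 'M[R]_n) (pi : 'rV[R]_n)
    (mu : R) : R :=
  eta_2 P pi mu / (1 - eta_2 P pi mu).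

Definition good_coordinate (R : realType) (n : nat) (P : 'M[R]_n)
    (pi : 'rV[R]_n) (beta : R) (y : 'rV[R]_n) (i : 'I_n) : Prop :=
  let r := y *m laplacian_norm P pi in
  `|r 0 i| ^+ 2 >= beta * norm2 r ^+ 2.

(* [delta_mx j j] is the diagonal matrix I_{j} with a single 1. *)
Fixpoint rlgl (R : realType) (n : nat) (P : 'M[R]_n) (x0 : 'rV[R]_n)
    (i : nat -> 'I_n) (t : nat) : 'rV[R]_n :=
  if t is s.+1 then
    let x := rlgl P x0 i s in x - x *m (1%:M - P) *m delta_mx (i s) (i s)
  else x0.

Definition rlgl_y (R : realType) (n : nat) (P : 'M[R]_n) (pi : 'rV[R]_n)
    (x0 : 'rV[R]_n) (i : nat -> 'I_n) (t : nat) : 'rV[R]_n :=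
  rlgl P x0 i t *m invmx (sqrt_diag pi).

Definition beta_tilde (R : realType) (beta gamma : R) : R :=
  ((Num.sqrt beta - gamma) / (1 + gamma)) ^+ 2.

(* Main.v *)
(* Write N = D P D^-1 with D = Pi^(1/2), so that L = 1 - (N + N^T)/2,
   A = (N - N^T)/2 and the residual is r = g - a with g = y L, a = y A.
   Updating coordinate j subtracts r_j e_j from y, and since L_jj <= 1 the
   form y L y^T drops by at least g_j^2 - a_j^2.  Near-reversibility gives
   |a| <= eta |g| with eta < 1, hence |a| <= gamma |r|, and the triangle
   inequality turns goodness of j for r into g_j^2 >= beta~ |g|^2.  The spectral
   gap gives |g|^2 >= mu y L y^T; irreducibility makes ker L the line spanned by
   sqrt pi, on which A also vanishes, so that a_j^2 <= kappa^2 |z|^2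
   <= (kappa^2 / mu) y L y^T for the component z of y orthogonal to sqrt pi. *)

Require Import Defs.
From mathcomp Require Import all_boot all_order all_algebra.
From mathcomp Require Import reals.
From mathcomp Require Import complex ring lra.

Set Implicit Arguments.
Unset Strict Implicit.
Unset Printing Implicit Defensive.

Import Order.TTheory GRing.Theory Num.Theory.
Local Open Scope ring_scope.

(** * Spectral measures of symmetric matrices and the spectral gap *)

(* The weights [w] are the masses of the spectral measure of [M] at [u]. *)
Lemma hermitian_spectral_measure (C : numClosedFieldType) (n : nat)
    (M : 'M[C]_n) (u : 'rV[C]_n) :
  M \is hermsymmx ->
  exists lam w : 'I_n -> C,
    [/\ forall j, lam j \is Num.real, forall j, eigenvalue M (lam j),
        forall j, 0 <= w j
      & forall k, (u *m M ^+ k *m map_mx Num.conj u^T) 0 0 =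
          \sum_j lam j ^+ k * w j].
Proof.
move=> Mherm.
have /orthomx_spectralP := hermitian_normalmx Mherm.
move: (spectralmx M) (spectral_unit M) (spectral_unitarymx M) => U Uu Uunitary.
move: (spectral_diag M) (mxOverP (hermitian_spectral_diag_real Mherm)).
move=> d dreal ME.
have UV : invmx U = map_mx Num.conj U^T by apply: invmx_unitary.
have MkE k : M ^+ k = invmx U *m diag_mx (map_mx (fun x => x ^+ k) d) *m U.
  elim: k => [|k IHk].
    have -> : map_mx (fun x => x ^+ 0) d = const_mx 1.
      by apply/rowP => j; rewrite !mxE expr0.
    by rewrite expr0 diag_const_mx mulmx1 mulVmx.
  rewrite exprSr IHk -mulmxE ME !mulmxA mulmxK //; congr (_ *m _).
  rewrite -!mulmxA; congr (_ *m _).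
  by apply/matrixP => i j; rewrite mul_diag_mx !mxE exprSr mulrnAr.
(* The entries of [v] are the coordinates of [u] in the orthonormal eigenbasis given by the rows of
   [U]; their squared moduli are the weights. *)
pose v := u *m invmx U.
exists (d 0), (fun j => `|v 0 j| ^+ 2); split => // [j|j|k].
- apply/eigenvalueP; exists (row j U).
    rewrite ME -row_mul !mulmxA mulmxV // mul1mx.
    by apply/rowP => k; rewrite mul_diag_mx !mxE.
  apply/eqP => /(congr1 (fun x => x *m invmx U)).
  rewrite -row_mul mulmxV // mul0mx => /rowP/(_ j).
  by rewrite !mxE eqxx => /eqP; rewrite oner_eq0.
- exact: exprn_ge0.
rewrite MkE !mulmxA -(mulmxA _ U).
have -> : U *m map_mx Num.conj u^T = map_mx Num.conj v^T.
  rewrite /v trmx_mul map_mxM UV; congr (_ *m _).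
  by apply/matrixP => i j; rewrite !mxE [RHS]conjCK.
rewrite -/v mxE; apply: eq_bigr => j _.
by rewrite mul_mx_diag !mxE normCK mulrAC mulrC.
Qed.

(** A real symmetric matrix is Hermitian over the complex extension of [R]. The eigenvalues and
    weights found there are real, so everything descends to [R] by taking real parts. *)
Lemma symmetric_spectral_measure (R : rcfType) (n : nat) (L : 'M[R]_n)
    (u : 'rV[R]_n) :
  L^T = L ->
  exists lam w : 'I_n -> R,
    [/\ forall j, eigenvalue L (lam j), forall j, 0 <= w j
      & forall k, (u *m L ^+ k *m u^T) 0 0 = \sum_j lam j ^+ k * w j].
Proof.
move=> Lsym; pose f := real_complex R.
have freal x : f x \is Num.real by apply/complex_realP; exists x.
have Lherm : map_mx f L \is hermsymmx.
  apply: realsym_hermsym; last by apply/mxOverP => i j; rewrite mxE freal.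
  by apply/is_hermitianmxP; rewrite expr0 scale1r map_mx_id // map_trmx Lsym.
have [lam [w [lamR lamP w_ge0 uE]]] :=
  hermitian_spectral_measure (map_mx f u) Lherm.
have lamE j : lam j = f (complex.Re (lam j)) by rewrite /f RRe_real.
have wE j : w j = f (complex.Re (w j)) by rewrite /f RRe_real // ger0_real.
have LkE k : map_mx f (L ^+ k) = map_mx f L ^+ k.
  elim: k => [|k IHk]; first by rewrite !expr0 map_mx1.
  by rewrite !exprS -!mulmxE map_mxM IHk.
exists (fun j => complex.Re (lam j)), (fun j => complex.Re (w j)).
split=> [j|j|k].
- by rewrite -(eigenvalue_map f) -[X in eigenvalue _ X]lamE.
- by rewrite -ler0c -[X in _ <= X]wE.
apply: (@complexI R); rewrite [RHS](rmorph_sum (real_complex R)).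
transitivity (map_mx f (u *m L ^+ k *m u^T) 0 0); first by rewrite [RHS]mxE.
rewrite !map_mxM LkE.
have -> : map_mx f u^T = map_mx Num.conj (map_mx f u)^T.
  by apply/matrixP => i j; rewrite !mxE (CrealP (freal _)).
by rewrite uE; apply: eq_bigr => j _; rewrite rmorphM rmorphXn [LHS]/= {1}lamE {1}wE.
Qed.

(** The inequality is compared term by term under the spectral measure. Both powers of [L] are
    positive, so the eigenvalue 0 contributes nothing to either side, and every other eigenvalue is
    at least [mu]. *)
Lemma spectral_gap (R : rcfType) (n : nat) (L : 'M[R]_n) (mu : R) (k : nat)
    (u : 'rV[R]_n) :
  L^T = L -> 0 <= mu ->
  (forall a, eigenvalue L a -> a != 0 -> mu <= a) ->
  mu * (u *m L ^+ k.+1 *m u^T) 0 0 <= (u *m L ^+ k.+2 *m u^T) 0 0.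
Proof.
move=> Lsym mu_ge0 mu_min.
have [lam [w [lamP w_ge0 uE]]] := symmetric_spectral_measure u Lsym.
rewrite !uE mulr_sumr ler_sum // => j _; rewrite mulrA ler_wpM2r //.
have [->|lam0] := eqVneq (lam j) 0; first by rewrite !expr0n mulr0.
have mu_le := mu_min _ (lamP j) lam0.
by rewrite [leRHS]exprS ler_wpM2r // exprn_ge0 // (le_trans mu_ge0).
Qed.

(** For symmetric [L] the orthogonal complement of the kernel is the row space. Hence [z = u *m L]
    for some [u], and the claim is the spectral gap at [u] for the second and third powers of
    [L]. *)
Lemma spectral_gap_orthogonal (R : rcfType) (n : nat) (L : 'M[R]_n) (mu : R)
    (v z : 'rV[R]_n) :
  L^T = L -> 0 <= mu ->
  (forall a, eigenvalue L a -> a != 0 -> mu <= a) ->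
  (forall w : 'rV[R]_n, w *m L = 0 -> (w <= v)%MS) ->
  z *m v^T = 0 ->
  mu * (z *m z^T) 0 0 <= (z *m L *m z^T) 0 0.
Proof.
move=> Lsym mu_ge0 mu_min kerL zv.
have vz : v *m z^T = 0 by rewrite -[LHS]trmxK trmx_mul trmxK zv trmx0.
(* The columns of the cokernel, transposed, are killed by [L] by symmetry, hence are multiples of
   [v] and orthogonal to [z]. *)
have /submxP[u ->] : (z <= L)%MS.
  rewrite submxE -trmx_eq0 trmx_mul; apply/eqP/row_matrixP => i.
  rewrite row_mul row0.
  have /kerL/submxP[c ->] : row i (cokermx L)^T *m L = 0.
    by rewrite -row_mul -[X in _ *m X]Lsym -trmx_mul mulmx_coker trmx0 row0.
  by rewrite -mulmxA vz mulmx0.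
rewrite trmx_mul Lsym !mulmxA.
have := spectral_gap 1 u Lsym mu_ge0 mu_min.
by rewrite !exprS expr0 mulr1 -!mulmxE !mulmxA.
Qed.

(** * The Euclidean norm and antisymmetric matrices *)

Lemma dotrvE (R : realType) (n : nat) (u v : 'rV[R]_n) :
  (u *m v^T) 0 0 = \sum_j u 0 j * v 0 j.
Proof. by rewrite mxE; apply: eq_bigr => j _; rewrite mxE. Qed.

Lemma norm2_ge0 (R : realType) (n : nat) (v : 'rV[R]_n) : 0 <= norm2 v.
Proof. exact: sqrtr_ge0. Qed.

Lemma sqr_norm2E (R : realType) (n : nat) (v : 'rV[R]_n) :
  norm2 v ^+ 2 = \sum_j v 0 j ^+ 2.
Proof. by rewrite sqr_sqrtr // sumr_ge0 // => j _; apply: sqr_ge0. Qed.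

Lemma sqr_norm2 (R : realType) (n : nat) (v : 'rV[R]_n) :
  norm2 v ^+ 2 = (v *m v^T) 0 0.
Proof. by rewrite dotrvE sqr_norm2E. Qed.

Lemma norm2_eq0 (R : realType) (n : nat) (v : 'rV[R]_n) :
  (norm2 v == 0) = (v == 0).
Proof.
rewrite -sqrf_eq0 sqr_norm2E psumr_eq0 => [|j _]; last exact: sqr_ge0.
apply/allP/eqP => [v0|-> j _]; last by rewrite mxE expr0n /= eqxx.
apply/rowP => j; rewrite mxE; apply/eqP.
by rewrite -sqrf_eq0; apply: v0; apply: mem_index_enum.
Qed.

Lemma cauchy_schwarz (R : realType) (n : nat) (u v : 'rV[R]_n) :
  (u *m v^T) 0 0 ^+ 2 <= norm2 u ^+ 2 * norm2 v ^+ 2.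
Proof.
rewrite -subr_ge0 !sqr_norm2E dotrvE.
have : 0 <= \sum_i \sum_j (u 0 i * v 0 j - u 0 j * v 0 i) ^+ 2.
  by do 2!apply: sumr_ge0 => ? _; apply: sqr_ge0.
(* Lagrange's identity: the double sum of squares is twice the Cauchy-Schwarz defect. *)
suff -> : \sum_i \sum_j (u 0 i * v 0 j - u 0 j * v 0 i) ^+ 2 =
    2 * ((\sum_j u 0 j ^+ 2) * (\sum_j v 0 j ^+ 2)
         - (\sum_j u 0 j * v 0 j) ^+ 2) by rewrite pmulr_rge0 ?ltr0n.
rewrite mulrBr mulr_natl mulr2n {2}[_ * \sum_j _]mulrC expr2 !big_distrlr /=.
rewrite mulr_sumr -!big_split -sumrB; apply: eq_bigr => i _ /=.
by rewrite mulr_sumr -!big_split -sumrB; apply: eq_bigr => j _ /=; ring.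
Qed.

Lemma ler_norm2D (R : realType) (n : nat) (u v : 'rV[R]_n) :
  norm2 (u + v) <= norm2 u + norm2 v.
Proof.
rewrite -ler_sqr ?nnegrE ?addr_ge0 ?norm2_ge0 //.
have : (u *m v^T) 0 0 <= norm2 u * norm2 v.
  apply: le_trans (ler_norm _) _.
  rewrite -ler_sqr ?nnegrE ?mulr_ge0 ?norm2_ge0 // real_normK ?num_real //.
  by rewrite exprMn cauchy_schwarz.
rewrite sqrrD !sqr_norm2E dotrvE => uv.
have -> : \sum_j (u + v) 0 j ^+ 2 =
    \sum_j u 0 j ^+ 2 + 2 * (\sum_j u 0 j * v 0 j) + \sum_j v 0 j ^+ 2.
  rewrite mulr_sumr -!big_split; apply: eq_bigr => j _ /=.
  by rewrite mxE; ring.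
by rewrite lerD2r lerD2l mulr_natl lerMn2r.
Qed.

Lemma norm2N (R : realType) (n : nat) (v : 'rV[R]_n) : norm2 (- v) = norm2 v.
Proof. by congr Num.sqrt; apply: eq_bigr => j _; rewrite mxE sqrrN. Qed.

(** Column [j] of an antisymmetric matrix is minus its row [j], so Cauchy-Schwarz bounds the entry
    by a row norm; this is how [kappa_row] enters. *)
Lemma antisym_entry_le (R : realType) (n : nat) (A : 'M[R]_n) (z : 'rV[R]_n)
    (j : 'I_n) :
  A^T = - A -> (z *m A) 0 j ^+ 2 <= norm2 z ^+ 2 * norm2 (row j A) ^+ 2.
Proof.
move=> Aanti; apply: le_trans (cauchy_schwarz _ _).
have -> : (z *m (row j A)^T) 0 0 = - (z *m A) 0 j.
  rewrite dotrvE mxE -sumrN; apply: eq_bigr => k _.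
  by move/matrixP/(_ k j): Aanti; rewrite !mxE => ->; rewrite mulrN.
by rewrite sqrrN.
Qed.

Lemma antisym_norm2_le (R : realType) (n : nat) (A : 'M[R]_n) (z : 'rV[R]_n) :
  A^T = - A ->
  norm2 (z *m A) ^+ 2 <= norm2 z ^+ 2 * \sum_j norm2 (row j A) ^+ 2.
Proof.
move=> Aanti; rewrite sqr_norm2E mulr_sumr ler_sum // => j _.
exact: antisym_entry_le.
Qed.

(** * Conjugation by the square root of the stationary law *)

Definition conj_transition (R : realType) (n : nat) (P : 'M[R]_n)
    (pi : 'rV[R]_n) : 'M[R]_n :=
  sqrt_diag pi *m P *m invmx (sqrt_diag pi).

(* The unit vector spanning the kernel of the Laplacian. *)
Definition sqrt_pi (R : realType) (n : nat) (pi : 'rV[R]_n) : 'rV[R]_n :=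
  map_mx Num.sqrt pi.

Lemma tr_sqrt_diag (R : realType) (n : nat) (pi : 'rV[R]_n) :
  (sqrt_diag pi)^T = sqrt_diag pi.
Proof. exact: tr_diag_mx. Qed.

Lemma sqrt_diag_unit (R : realType) (n : nat) (pi : 'rV[R]_n) :
  (forall j, 0 < pi 0 j) -> sqrt_diag pi \in unitmx.
Proof.
move=> pi_gt0; rewrite unitmxE det_diag unitfE.
by apply/prodf_neq0 => j _; rewrite mxE gt_eqF ?sqrtr_gt0.
Qed.

Lemma sqrt_diag_sqr (R : realType) (n : nat) (pi : 'rV[R]_n) :
  (forall j, 0 < pi 0 j) -> sqrt_diag pi *m sqrt_diag pi = diag_mx pi.
Proof.
move=> pi_gt0; rewrite mulmx_diag; congr diag_mx; apply/rowP => j.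
by rewrite !mxE -expr2 sqr_sqrtr // ltW.
Qed.

Lemma tr_conj_transition (R : realType) (n : nat) (P : 'M[R]_n)
    (pi : 'rV[R]_n) :
  (conj_transition P pi)^T = invmx (sqrt_diag pi) *m P^T *m sqrt_diag pi.
Proof. by rewrite !trmx_mul trmx_inv tr_sqrt_diag mulmxA. Qed.

(** Time reversal becomes transposition after conjugation, which makes [sym_part] and [antisym_part]
    the symmetric and antisymmetric parts of [conj_transition]. *)
Lemma conj_transition_reversal (R : realType) (n : nat) (P : 'M[R]_n)
    (pi : 'rV[R]_n) :
  (forall j, 0 < pi 0 j) ->
  conj_transition (reversal P pi) pi = (conj_transition P pi)^T.
Proof.
move=> pi_gt0; have Du := sqrt_diag_unit pi_gt0.
have DD := sqrt_diag_sqr pi_gt0.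
have DDu : diag_mx pi \in unitmx by rewrite -DD unitmx_mul Du.
have DV : sqrt_diag pi *m invmx (diag_mx pi) = invmx (sqrt_diag pi).
  by apply: (canLR (mulmxK DDu)); rewrite -DD mulmxA mulVmx // mul1mx.
rewrite tr_conj_transition /conj_transition /reversal !mulmxA DV.
by rewrite -DD mulmxA mulmxK.
Qed.

Lemma laplacian_normE (R : realType) (n : nat) (P : 'M[R]_n) (pi : 'rV[R]_n) :
  laplacian_norm P pi = laplacian P pi - antisym_part P pi.
Proof.
rewrite /laplacian /sym_part /antisym_part mulmxBr mulmxBl mulmxDr mulmxDl.
rewrite /laplacian_norm; move: (_ *m P *m _) (_ *m reversal _ _ *m _) => N M.
by apply/matrixP => i j; rewrite !mxE; field.
Qed.

Lemma laplacianE (R : realType) (n : nat) (P : 'M[R]_n) (pi : 'rV[R]_n) :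
  (forall j, 0 < pi 0 j) ->
  laplacian P pi =
    1%:M - 2^-1 *: (conj_transition P pi + (conj_transition P pi)^T).
Proof.
by move=> pi_gt0; rewrite -conj_transition_reversal // -mulmxDl -mulmxDr.
Qed.

Lemma antisym_partE (R : realType) (n : nat) (P : 'M[R]_n) (pi : 'rV[R]_n) :
  (forall j, 0 < pi 0 j) ->
  antisym_part P pi =
    2^-1 *: (conj_transition P pi - (conj_transition P pi)^T).
Proof.
by move=> pi_gt0; rewrite -conj_transition_reversal // -mulmxBl -mulmxBr.
Qed.

Lemma tr_laplacian (R : realType) (n : nat) (P : 'M[R]_n) (pi : 'rV[R]_n) :
  (forall j, 0 < pi 0 j) -> (laplacian P pi)^T = laplacian P pi.
Proof.
move=> pi_gt0; rewrite laplacianE // [LHS]linearB /= trmx1 linearZ /= linearD /=.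
by rewrite trmxK [X in _ *: X]addrC.
Qed.

Lemma tr_antisym_part (R : realType) (n : nat) (P : 'M[R]_n) (pi : 'rV[R]_n) :
  (forall j, 0 < pi 0 j) -> (antisym_part P pi)^T = - antisym_part P pi.
Proof.
move=> pi_gt0; rewrite antisym_partE // linearZ /= linearB /= trmxK.
by rewrite -scalerN opprB.
Qed.

Lemma sqrt_piE (R : realType) (n : nat) (pi : 'rV[R]_n) :
  (forall j, 0 < pi 0 j) -> sqrt_pi pi = pi *m invmx (sqrt_diag pi).
Proof.
move=> pi_gt0; apply: (canRL (mulmxK (sqrt_diag_unit pi_gt0))).
apply/rowP => j; rewrite mul_mx_diag !mxE -expr2 sqr_sqrtr //; exact: ltW.
Qed.

Lemma sqrt_pi_const (R : realType) (n : nat) (pi : 'rV[R]_n) :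
  sqrt_pi pi = const_mx 1 *m sqrt_diag pi.
Proof. by apply/rowP => j; rewrite mul_mx_diag !mxE mul1r. Qed.

Lemma norm2_sqrt_pi (R : realType) (n : nat) (P : 'M[R]_n) (pi : 'rV[R]_n) :
  stationary P pi -> norm2 (sqrt_pi pi) = 1.
Proof.
case=> pi_gt0 pi1 _; rewrite /norm2.
under eq_bigr do rewrite mxE sqr_sqrtr ?(ltW (pi_gt0 _)) //.
by rewrite pi1 sqrtr1.
Qed.

Lemma sqrt_pi_conj_transition (R : realType) (n : nat) (P : 'M[R]_n)
    (pi : 'rV[R]_n) :
  stationary P pi -> sqrt_pi pi *m conj_transition P pi = sqrt_pi pi.
Proof.
case=> pi_gt0 _ piP; rewrite sqrt_piE // /conj_transition !mulmxA.
by rewrite mulmxKV ?piP // sqrt_diag_unit.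
Qed.

Lemma sqrt_pi_tr_conj_transition (R : realType) (n : nat) (P : 'M[R]_n)
    (pi : 'rV[R]_n) :
  row_stochastic P -> (forall j, 0 < pi 0 j) ->
  sqrt_pi pi *m (conj_transition P pi)^T = sqrt_pi pi.
Proof.
case=> _ P1 pi_gt0; rewrite tr_conj_transition sqrt_pi_const !mulmxA.
rewrite mulmxK ?sqrt_diag_unit //; congr (_ *m _); apply/rowP => j.
by rewrite !mxE -[RHS](P1 j); apply: eq_bigr => k _; rewrite !mxE mul1r.
Qed.

Lemma sqrt_pi_antisym_part (R : realType) (n : nat) (P : 'M[R]_n)
    (pi : 'rV[R]_n) :
  row_stochastic P -> stationary P pi ->
  sqrt_pi pi *m antisym_part P pi = 0.
Proof.
move=> Pst pist; have [pi_gt0 _ _] := pist.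
rewrite antisym_partE // -scalemxAr mulmxBr sqrt_pi_conj_transition //.
by rewrite sqrt_pi_tr_conj_transition // subrr scaler0.
Qed.

Lemma sqrt_pi_laplacian (R : realType) (n : nat) (P : 'M[R]_n)
    (pi : 'rV[R]_n) :
  row_stochastic P -> stationary P pi -> sqrt_pi pi *m laplacian P pi = 0.
Proof.
move=> Pst pist; have [pi_gt0 _ _] := pist.
rewrite laplacianE // mulmxBr mulmx1 -scalemxAr mulmxDr.
rewrite sqrt_pi_conj_transition // sqrt_pi_tr_conj_transition //.
by apply/rowP => j; rewrite !mxE; field.
Qed.

(** * The Dirichlet form, its kernel and the Poincaré inequality *)

(** Expanding the square gives two diagonal sums and a cross term. Each diagonal sum equals the
    squared norm of [y], one by the unit row sums and the other by stationarity; the cross term is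
    the form of [conj_transition], which transposition leaves unchanged. *)
Lemma laplacian_formE (R : realType) (n : nat) (P : 'M[R]_n)
    (pi f : 'rV[R]_n) :
  row_stochastic P -> stationary P pi ->
  let y := f *m sqrt_diag pi in
  (y *m laplacian P pi *m y^T) 0 0 =
    2^-1 * \sum_i \sum_j pi 0 i * P i j * (f 0 i - f 0 j) ^+ 2.
Proof.
move=> [_ P1] [pi_gt0 _ piP] y; have Du := sqrt_diag_unit pi_gt0.
have sqE : (y *m y^T) 0 0 = \sum_i pi 0 i * f 0 i ^+ 2.
  rewrite dotrvE; apply: eq_bigr => i _; rewrite /y mul_mx_diag !mxE.
  by rewrite -expr2 exprMn sqr_sqrtr ?(ltW (pi_gt0 _)) // mulrC.
have NE : (y *m conj_transition P pi *m y^T) 0 0 =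
    \sum_i \sum_j pi 0 i * P i j * (f 0 i * f 0 j).
  rewrite /conj_transition /y trmx_mul tr_sqrt_diag !mulmxA mulmxKV //.
  rewrite -(mulmxA f) sqrt_diag_sqr // dotrvE exchange_big /=.
  apply: eq_bigr => j _; rewrite mxE mulr_suml; apply: eq_bigr => i _.
  by rewrite mul_mx_diag mxE; ring.
have NtE : (y *m (conj_transition P pi)^T *m y^T) 0 0 =
    (y *m conj_transition P pi *m y^T) 0 0.
  have tr00 (S : 'M[R]_1) : S^T 0 0 = S 0 0 by rewrite mxE.
  by rewrite -[LHS]tr00 !trmx_mul !trmxK mulmxA.
rewrite laplacianE // mulmxBr mulmx1 mulmxBl -scalemxAr -scalemxAl.
rewrite mulmxDr mulmxDl.
have -> : forall S T U : 'M[R]_1, (S - 2^-1 *: (T + U)) 0 0 =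
    S 0 0 - 2^-1 * (T 0 0 + U 0 0) by move=> S T U; rewrite !mxE.
rewrite NtE NE sqE.
have E1 : \sum_i \sum_j pi 0 i * P i j * f 0 i ^+ 2 = \sum_i pi 0 i * f 0 i ^+ 2.
  apply: eq_bigr => i _; rewrite -[in RHS](mulr1 (pi 0 i)) -(P1 i) mulr_sumr.
  by rewrite mulr_suml.
have E2 : \sum_i \sum_j pi 0 i * P i j * f 0 j ^+ 2 = \sum_i pi 0 i * f 0 i ^+ 2.
  rewrite exchange_big; apply: eq_bigr => j _ /=.
  by rewrite -mulr_suml; congr (_ * _); rewrite -[in RHS]piP mxE.
have -> : \sum_i \sum_j pi 0 i * P i j * (f 0 i - f 0 j) ^+ 2 =
    \sum_i \sum_j pi 0 i * P i j * f 0 i ^+ 2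
    + \sum_i \sum_j pi 0 i * P i j * f 0 j ^+ 2
    - 2 * \sum_i \sum_j pi 0 i * P i j * (f 0 i * f 0 j).
  rewrite mulr_sumr -big_split -sumrB; apply: eq_bigr => i _ /=.
  rewrite mulr_sumr -big_split -sumrB; apply: eq_bigr => j _ /=.
  by ring.
by rewrite E1 E2; field.
Qed.

Lemma laplacian_form_ge0 (R : realType) (n : nat) (P : 'M[R]_n)
    (pi y : 'rV[R]_n) :
  row_stochastic P -> stationary P pi ->
  0 <= (y *m laplacian P pi *m y^T) 0 0.
Proof.
move=> Pst pist; have [pi_gt0 _ _] := pist; have [P0 _] := Pst.
rewrite -[y](mulmxKV (sqrt_diag_unit pi_gt0)) laplacian_formE //.
rewrite mulr_ge0 ?invr_ge0 ?ler0n // !sumr_ge0 // => i _; apply: sumr_ge0 => j _.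
by rewrite mulr_ge0 ?sqr_ge0 // mulr_ge0 // ltW.
Qed.

Lemma stochastic_expr_ge0 (R : realType) (n : nat) (P : 'M[R]_n) (k : nat)
    (i j : 'I_n) : row_stochastic P -> 0 <= (P ^+ k) i j.
Proof.
case=> P0 _; elim: k i j => [|k IHk] i j; first by rewrite expr0 mxE ler0n.
by rewrite exprS -mulmxE mxE sumr_ge0 // => l _; rewrite mulr_ge0.
Qed.

(** Induction on the length of a path from [i] to [j]: a positive entry of the next power splits
    into a positive first step to some [l] and a positive entry from [l] to [j]. At length 0 the
    identity matrix forces [i = j]. *)
Lemma irreducible_const (R : realType) (n : nat) (P : 'M[R]_n)
    (f : 'I_n -> R) :
  row_stochastic P -> irreducible P ->
  (forall i j, 0 < P i j -> f i = f j) -> forall i j, f i = f j.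
Proof.
move=> Pst Pirr fP i j; have [P0 _] := Pst; have [k] := Pirr i j.
elim: k i => [|k IHk] i; first by rewrite expr0 mxE; case: eqP => [->//|_]; rewrite ltxx.
rewrite exprS -mulmxE mxE => /gt_eqF/eqP Pk.
have [l _|l /=] := psumr_neq0P _ Pk; first by rewrite mulr_ge0 ?stochastic_expr_ge0.
rewrite lt0r mulf_eq0 negb_or => /andP[/andP[Pil Plj] _].
rewrite (fP i l) ?lt0r ?Pil ?P0 //; apply: IHk.
by rewrite lt0r Plj stochastic_expr_ge0.
Qed.

Lemma const_row_sub (F : fieldType) (n : nat) (f : 'rV[F]_n) :
  (forall i j, f 0 i = f 0 j) -> (f <= (const_mx 1 : 'rV_n))%MS.
Proof.
case: n f => [|n] f fc; first by rewrite thinmx0 sub0mx.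
apply/submxP; exists (f 0 0)%:M; apply/rowP => j.
by rewrite mul_scalar_mx !mxE mulr1; apply: fc.
Qed.

(** Zero energy makes every term of the sum of squares vanish, so [f] agrees across each transition
    of positive probability. Irreducibility makes [f] constant, and rescaling gives a multiple of
    [sqrt_pi]. *)
Lemma laplacian_kernel (R : realType) (n : nat) (P : 'M[R]_n)
    (pi w : 'rV[R]_n) :
  row_stochastic P -> irreducible P -> stationary P pi ->
  w *m laplacian P pi = 0 -> (w <= sqrt_pi pi)%MS.
Proof.
move=> Pst Pirr pist wL; have [pi_gt0 _ _] := pist; have [P0 _] := Pst.
pose f := w *m invmx (sqrt_diag pi).
have wE : w = f *m sqrt_diag pi by rewrite mulmxKV // sqrt_diag_unit.
have t_ge0 i j : 0 <= pi 0 i * P i j * (f 0 i - f 0 j) ^+ 2.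
  by rewrite mulr_ge0 ?sqr_ge0 // mulr_ge0 // ltW.
have : (w *m laplacian P pi *m w^T) 0 0 = 0 by rewrite wL mul0mx mxE.
rewrite wE laplacian_formE // => /eqP; rewrite mulf_eq0 invr_eq0 pnatr_eq0 /=.
rewrite psumr_eq0 => [/allP f0|i _]; last exact: sumr_ge0.
have fP i j : 0 < P i j -> f 0 i = f 0 j.
  move=> Pij; have /= := f0 i (mem_index_enum _).
  rewrite psumr_eq0 // => /allP/(_ j (mem_index_enum _)) /=.
  by rewrite mulf_eq0 sqrf_eq0 mulf_eq0 (gt_eqF (pi_gt0 i)) (gt_eqF Pij) subr_eq0 => /eqP.
have fc := irreducible_const Pst Pirr fP.
by rewrite sqrt_pi_const submxMr // const_row_sub.
Qed.

(** The energy of an eigenvector is [mu] times its squared norm, and the form is nonnegative. *)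
Lemma poincare_constant_gt0 (R : realType) (n : nat) (P : 'M[R]_n)
    (pi : 'rV[R]_n) (mu : R) :
  row_stochastic P -> stationary P pi -> poincare_constant P pi mu -> 0 < mu.
Proof.
move=> Pst pist [/eigenvalueP[w wL w0] mu0 _]; rewrite lt0r mu0.
have := laplacian_form_ge0 w Pst pist.
rewrite wL -scalemxAl mxE -sqr_norm2 pmulr_lge0 //.
by rewrite exprn_gt0 // lt0r norm2_ge0 norm2_eq0 w0.
Qed.

(** Conjugation by a diagonal matrix keeps diagonal entries, so the entry is [1 - P j j]. *)
Lemma laplacian_diag_le1 (R : realType) (n : nat) (P : 'M[R]_n)
    (pi : 'rV[R]_n) (j : 'I_n) :
  row_stochastic P -> stationary P pi -> laplacian P pi j j <= 1.
Proof.
move=> [P0 _] [pi_gt0 _ _]; have Du := sqrt_diag_unit pi_gt0.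
have sj_gt0 : 0 < Num.sqrt (pi 0 j) by rewrite sqrtr_gt0.
have NE : conj_transition P pi j j = P j j.
  have : (conj_transition P pi *m sqrt_diag pi) j j = (sqrt_diag pi *m P) j j.
    by rewrite mulmxKV.
  rewrite mul_mx_diag mul_diag_mx !mxE [RHS]mulrC => /mulIf; apply.
  by rewrite gt_eqF.
rewrite laplacianE //.
have -> : forall N : 'M[R]_n, (1%:M - 2^-1 *: (N + N^T)) j j = 1 - N j j.
  by move=> N; rewrite !mxE eqxx mulr1n; field.
by rewrite NE gerBl.
Qed.

(* Both [y] and its component [z] orthogonal to [sqrt_pi] have the same energy,
   so the Poincare inequality may be applied to [z]. *)
Lemma laplacian_energy_bounds (R : realType) (n : nat) (P : 'M[R]_n)
    (pi y : 'rV[R]_n) (mu : R) :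
  row_stochastic P -> irreducible P -> stationary P pi ->
  poincare_constant P pi mu ->
  let E := (y *m laplacian P pi *m y^T) 0 0 in
  mu * E <= norm2 (y *m laplacian P pi) ^+ 2 /\
  exists z, y *m antisym_part P pi = z *m antisym_part P pi /\
            mu * norm2 z ^+ 2 <= E.
Proof.
move=> Pst Pirr pist hmu E; have [pi_gt0 _ _] := pist.
have mu_ge0 := ltW (poincare_constant_gt0 Pst pist hmu).
have [_ _ mu_min] := hmu; have Lsym := tr_laplacian P pi_gt0.
split.
  have := spectral_gap 0 y Lsym mu_ge0 mu_min.
  by rewrite expr1 expr2 -mulmxE sqr_norm2 trmx_mul Lsym !mulmxA.
(* Since [v] is a unit vector, [z] is [y] minus its orthogonal projection on the line of [v]. *)
set v := sqrt_pi pi; pose c := (y *m v^T) 0 0; pose z := y - c *: v.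
have vL : v *m laplacian P pi = 0 by apply: sqrt_pi_laplacian.
have vA : v *m antisym_part P pi = 0 by apply: sqrt_pi_antisym_part.
exists z; split.
  by rewrite mulmxBl -scalemxAl vA scaler0 subr0.
have -> : E = (z *m laplacian P pi *m z^T) 0 0.
  have Lv : laplacian P pi *m v^T = 0.
    by rewrite -[X in X *m _]Lsym -trmx_mul vL trmx0.
  have -> : z^T = y^T - c *: v^T by rewrite linearB linearZ.
  rewrite mulmxBl -scalemxAl vL scaler0 subr0.
  by rewrite mulmxBr -scalemxAr -(mulmxA y _ v^T) Lv mulmx0 scaler0 subr0.
rewrite sqr_norm2.
apply: (@spectral_gap_orthogonal _ _ _ _ v) => // [w wL|].
  exact: laplacian_kernel wL.
rewrite mulmxBl -scalemxAl; apply/matrixP => a b; rewrite !ord1.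
have -> : forall S T : 'M[R]_1, (S - c *: T) 0 0 = S 0 0 - c * T 0 0.
  by move=> S T; rewrite !mxE.
by rewrite -sqr_norm2 (norm2_sqrt_pi pist) expr1n mulr1 subrr mxE.
Qed.

(** * One coordinate update and its effect on the energy *)

(** The diagonal matrices [delta_mx j j] and [sqrt_diag pi] commute, and the change of variable
    turns [1%:M - P] into [laplacian_norm]. *)
Lemma rlgl_yS (R : realType) (n : nat) (P : 'M[R]_n) (pi x0 : 'rV[R]_n)
    (i : nat -> 'I_n) (t : nat) :
  (forall j, 0 < pi 0 j) ->
  let y := rlgl_y P pi x0 i t in
  rlgl_y P pi x0 i t.+1 =
    y - (y *m laplacian_norm P pi) 0 (i t) *: delta_mx 0 (i t).
Proof.
move=> pi_gt0; have Du := sqrt_diag_unit pi_gt0.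
rewrite /rlgl_y /=; move: (rlgl _ _ _ _) (i t) => x j.
rewrite mulmxBl; congr (_ - _).
have deltaC : delta_mx j j *m invmx (sqrt_diag pi) =
    invmx (sqrt_diag pi) *m delta_mx j j.
  apply: (canLR (mulmxK Du)); rewrite -mulmxA.
  have -> : delta_mx j j *m sqrt_diag pi = sqrt_diag pi *m delta_mx j j.
    apply/matrixP => a b; rewrite mul_mx_diag mul_diag_mx !mxE mulrC.
    by have [->|] := eqVneq a j; have [->|] := eqVneq b j; rewrite //= !mulr0.
  by rewrite mulmxA mulVmx // mul1mx.
rewrite -(mulmxA _ (delta_mx j j)) deltaC mulmxA.
have -> : x *m (1%:M - P) *m invmx (sqrt_diag pi) =
    x *m invmx (sqrt_diag pi) *m laplacian_norm P pi.
  rewrite /laplacian_norm !mulmxBr !mulmx1 mulmxBl !mulmxA.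
  by rewrite mulmxKV.
set r := x *m _ *m _; apply/rowP => b; rewrite !mxE (bigD1 j) //= big1 => [|k kj].
  by rewrite !mxE eqxx addr0.
by rewrite !mxE (negbTE kj) mulr0.
Qed.

Lemma coordinate_step_form (R : comPzRingType) (n : nat) (L : 'M[R]_n)
    (y : 'rV[R]_n) (c : R) (j : 'I_n) :
  L^T = L ->
  let y' := y - c *: delta_mx 0 j in
  (y' *m L *m y'^T) 0 0 =
    (y *m L *m y^T) 0 0 - 2 * c * (y *m L) 0 j + c ^+ 2 * L j j.
Proof.
move=> Lsym; pose e : 'rV[R]_n := delta_mx 0 j; rewrite /= -/e.
have -> : (y - c *: e)^T = y^T - c *: e^T by rewrite linearB linearZ.
rewrite mulmxBl mulmxBr !mulmxBl -!scalemxAl -!scalemxAr.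
have mulE (u : 'rV[R]_n) : (u *m e^T) 0 0 = u 0 j.
  by rewrite trmx_delta -colE mxE.
have eL : (e *m L *m y^T) 0 0 = (y *m L) 0 j.
  have tr00 (S : 'M[R]_1) : S^T 0 0 = S 0 0 by rewrite mxE.
  by rewrite -[LHS]tr00 !trmx_mul trmxK Lsym mulmxA mulE.
have eLe : (e *m L *m e^T) 0 0 = L j j by rewrite mulE -rowE mxE.
have -> : forall S T U V : 'M[R]_1, (S - c *: T - (c *: U - c *: (c *: V))) 0 0 =
    S 0 0 - c * T 0 0 - (c * U 0 0 - c * (c * V 0 0)).
  by move=> S T U V; rewrite !mxE.
by rewrite eL eLe mulE; ring.
Qed.

Lemma abs_coord_le_norm2 (R : realType) (n : nat) (v : 'rV[R]_n) (j : 'I_n) :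
  `|v 0 j| <= norm2 v.
Proof.
rewrite -ler_sqr ?nnegrE ?norm2_ge0 // real_normK ?num_real // sqr_norm2E.
by rewrite (bigD1 j) //= lerDl sumr_ge0 // => k _; apply: sqr_ge0.
Qed.

Lemma good_coordinate_perturb (R : realType) (n : nat) (g a : 'rV[R]_n)
    (eta beta : R) (j : 'I_n) :
  0 <= eta < 1 -> 0 <= beta -> norm2 a <= eta * norm2 g ->
  let gamma := eta / (1 - eta) in
  gamma <= Num.sqrt beta ->
  beta * norm2 (g - a) ^+ 2 <= `|(g - a) 0 j| ^+ 2 ->
  beta_tilde beta gamma * norm2 g ^+ 2 <= g 0 j ^+ 2.
Proof.
move=> /andP[eta0 eta1] beta0 aLe gamma gammaLe good.
have eta1' : 0 < 1 - eta by rewrite subr_gt0.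
have gamma0 : 0 <= gamma by rewrite divr_ge0 // ltW.
set s := Num.sqrt beta in gammaLe *.
have s0 : 0 <= s := sqrtr_ge0 _.
have gLe : norm2 g <= norm2 (g - a) + norm2 a.
  by rewrite -{1}(subrK a g) ler_norm2D.
(* With [r = g - a], the bound [|a| <= eta (|r| + |a|)] is solved for [|a|], which is possible
   because [eta < 1]. *)
have aLe' : norm2 a <= gamma * norm2 (g - a).
  rewrite /gamma mulrAC ler_pdivlMr //.
  have : eta * norm2 g <= eta * (norm2 (g - a) + norm2 a) by rewrite ler_wpM2l.
  lra.
have good' : s * norm2 (g - a) <= `|(g - a) 0 j|.
  rewrite -ler_sqr ?nnegrE ?mulr_ge0 ?norm2_ge0 //.
  by rewrite exprMn sqr_sqrtr.
have gj : (s - gamma) * norm2 (g - a) <= `|g 0 j|.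
  have := abs_coord_le_norm2 a j; have := ler_normB (g 0 j) (a 0 j).
  move: good'; rewrite !mxE; lra.
(* This uses [|g| <= (1 + gamma) |r|] and [s - gamma >= 0]. *)
have key : (s - gamma) / (1 + gamma) * norm2 g <= `|g 0 j|.
  apply: le_trans gj; rewrite -mulrA ler_wpM2l ?subr_ge0 //.
  by rewrite mulrC ler_pdivrMr ?ltr_pwDl //; lra.
rewrite /beta_tilde -/s -exprMn -[leRHS]real_normK ?num_real //.
rewrite ler_sqr ?nnegrE // mulr_ge0 ?norm2_ge0 // divr_ge0 ?subr_ge0 //.
by rewrite addr_ge0.
Qed.

Lemma kappa_row_le (R : realType) (n : nat) (P : 'M[R]_n) (pi : 'rV[R]_n)
    (j : 'I_n) : kappa_row P pi j <= kappa P pi.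
Proof. exact: (le_bigmax 0 (kappa_row P pi) j). Qed.

Lemma sum_sqr_kappa_row_le (R : realType) (n : nat) (P : 'M[R]_n)
    (pi : 'rV[R]_n) :
  \sum_j kappa_row P pi j ^+ 2 <= n%:R * kappa P pi ^+ 2.
Proof.
rewrite -[n in n%:R]card_ord mulr_natl -sumr_const; apply: ler_sum => j _.
by rewrite lerXn2r ?nnegrE ?(le_trans (norm2_ge0 _) (kappa_row_le _ _ j)) //
  ?norm2_ge0 // kappa_row_le.
Qed.

Lemma dirichlet_step (R : realType) (n : nat) (P : 'M[R]_n)
    (pi y : 'rV[R]_n) (mu eta beta : R) (j : 'I_n) :
  row_stochastic P -> irreducible P -> stationary P pi ->
  poincare_constant P pi mu ->
  0 <= eta < 1 -> \sum_k kappa_row P pi k ^+ 2 <= (eta * mu) ^+ 2 ->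
  0 <= beta ->
  let gamma := eta / (1 - eta) in
  gamma <= Num.sqrt beta ->
  good_coordinate P pi beta y j ->
  dirichlet P pi (y - (y *m laplacian_norm P pi) 0 j *: delta_mx 0 j) <=
    (1 - beta_tilde beta gamma * mu + kappa P pi ^+ 2 / mu) * dirichlet P pi y.
Proof.
move=> Pst Pirr pist hmu eta01 kLe beta0 gamma gammaLe.
rewrite /good_coordinate /= /dirichlet.
have [pi_gt0 _ _] := pist; have mu_gt0 := poincare_constant_gt0 Pst pist hmu.
have [eta0 _] := andP eta01.
have [] := laplacian_energy_bounds y Pst Pirr pist hmu.
rewrite coordinate_step_form ?tr_laplacian //.
rewrite laplacian_normE (mulmxBr y (laplacian P pi)).
set g := y *m laplacian P pi; set a := y *m antisym_part P pi.
set E := (g *m y^T) 0 0 => gE [z [az zE]] good.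
have Aanti := tr_antisym_part P pi_gt0.
(* The two energy bounds are chained: [mu^2 |z|^2 <= mu E <= |g|^2]. The factor [mu^2] then cancels
   the one in the bound on the row norms of the antisymmetric part. *)
have zg : mu ^+ 2 * norm2 z ^+ 2 <= norm2 g ^+ 2.
  by rewrite expr2 -mulrA (le_trans _ gE) // ler_wpM2l // ltW.
have aLe : norm2 a <= eta * norm2 g.
  rewrite -ler_sqr ?nnegrE ?mulr_ge0 ?norm2_ge0 //.
  rewrite az (le_trans (antisym_norm2_le z Aanti)) //.
  apply: le_trans (_ : norm2 z ^+ 2 * (eta * mu) ^+ 2 <= _).
    by rewrite ler_wpM2l ?sqr_ge0.
  by rewrite mulrC !exprMn -mulrA ler_wpM2l ?sqr_ge0.
have gj := good_coordinate_perturb eta01 beta0 aLe gammaLe good.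
have aj : a 0 j ^+ 2 <= kappa P pi ^+ 2 / mu * E.
  rewrite az (le_trans (antisym_entry_le z j Aanti)) //.
  apply: le_trans (_ : norm2 z ^+ 2 * kappa P pi ^+ 2 <= _).
    rewrite ler_wpM2l ?sqr_ge0 // lerXn2r ?nnegrE ?norm2_ge0 //.
      exact: le_trans (norm2_ge0 _) (kappa_row_le P pi j).
    exact: kappa_row_le.
  rewrite mulrC -mulrA ler_wpM2l ?sqr_ge0 // mulrC ler_pdivlMr //.
  by rewrite mulrC.
have Ljj : (g - a) 0 j ^+ 2 * laplacian P pi j j <= (g - a) 0 j ^+ 2.
  by rewrite ler_piMr ?sqr_ge0 // laplacian_diag_le1.
have bE : beta_tilde beta gamma * (mu * E) <= beta_tilde beta gamma * norm2 g ^+ 2.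
  by rewrite ler_wpM2l // sqr_ge0.
rewrite mulrCA ler_wpM2l ?invr_ge0 ?ler0n //.
have rE : (g - a) 0 j = g 0 j - a 0 j by rewrite !mxE.
(* With [r = g_j - a_j], the energy changes by [-2 r g_j + r^2 L_jj], at most
   [-2 r g_j + r^2 = a_j^2 - g_j^2]; the bounds [gj], [bE] and [aj] finish. *)
move: Ljj; rewrite rE; move: gj aj bE; nra.
Qed.

(** * Consequences of near-reversibility *)

Lemma kappa_ge0 (R : realType) (n : nat) (P : 'M[R]_n) (pi : 'rV[R]_n) :
  0 <= kappa P pi.
Proof. exact: bigmax_ge_id. Qed.

Lemma nearly_reversible_sqrt_eta_inf_lt1 (R : realType) (n : nat)
    (P : 'M[R]_n) (pi : 'rV[R]_n) (mu : R) :
  (0 < n)%N -> nearly_reversible P pi mu -> Num.sqrt n%:R * eta_inf P pi mu < 1.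
Proof.
move=> n_gt0; rewrite /nearly_reversible => hnr.
have sn_gt0 : 0 < Num.sqrt n%:R :> R by rewrite sqrtr_gt0 ltr0n.
have n_pos : 0 < n%:R :> R by rewrite ltr0n.
have den_gt0 : 0 < 2 * n%:R + Num.sqrt n%:R :> R by lra.
have : Num.sqrt n%:R * eta_inf P pi mu < Num.sqrt n%:R * (1 / (2 * n%:R + Num.sqrt n%:R)).
  by rewrite ltr_pM2l.
move=> /lt_trans; apply.
by rewrite mulrA mulr1 ltr_pdivrMr // mul1r; lra.
Qed.

Lemma eta_2_le (R : realType) (n : nat) (P : 'M[R]_n) (pi : 'rV[R]_n) (mu : R) :
  0 < mu -> eta_2 P pi mu <= Num.sqrt n%:R * eta_inf P pi mu.
Proof.
move=> mu_gt0; rewrite /eta_2 /eta_inf mulrC mulrA ler_wpM2r ?invr_ge0 ?(ltW mu_gt0) //.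
(* Writing [kappa] as the square root of its square puts both sides under one root. *)
rewrite -(ger0_norm (kappa_ge0 P pi)) -sqrtr_sqr -sqrtrM ?ler0n //.
by rewrite ler_wsqrtr // sum_sqr_kappa_row_le.
Qed.

(** Both choices of [gamma] have the form [eta / (1 - eta)], with [eta] equal to
    [Num.sqrt n%:R * eta_inf] or to [eta_2]. The descent estimate needs only the listed bounds on
    [eta], so it serves both cases. *)
Lemma gamma_eta (R : realType) (n : nat) (P : 'M[R]_n) (pi : 'rV[R]_n)
    (mu gamma : R) :
  (0 < n)%N -> 0 < mu -> nearly_reversible P pi mu ->
  gamma = gamma_inf P pi mu \/ gamma = gamma_2 P pi mu ->
  exists eta, [/\ 0 <= eta < 1,
    \sum_k kappa_row P pi k ^+ 2 <= (eta * mu) ^+ 2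
    & gamma = eta / (1 - eta)].
Proof.
move=> n_gt0 mu_gt0 hnr; have lt1 := nearly_reversible_sqrt_eta_inf_lt1 n_gt0 hnr.
have sum_ge0 : 0 <= \sum_k kappa_row P pi k ^+ 2.
  by apply: sumr_ge0 => k _; apply: sqr_ge0.
case=> ->.
  exists (Num.sqrt n%:R * eta_inf P pi mu); split=> //.
    by rewrite lt1 mulr_ge0 ?sqrtr_ge0 // divr_ge0 ?kappa_ge0 // ltW.
  rewrite /eta_inf -mulrA mulfVK ?gt_eqF // exprMn sqr_sqrtr ?ler0n //.
  exact: sum_sqr_kappa_row_le.
exists (eta_2 P pi mu); split=> //.
  rewrite (le_lt_trans (eta_2_le P pi mu_gt0) lt1) andbT.
  by rewrite mulr_ge0 ?sqrtr_ge0 // invr_ge0 ltW.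
by rewrite /eta_2 mulrAC mulVf ?gt_eqF // mul1r sqr_sqrtr.
Qed.

(** * Iteration of the one-step estimate *)

(* A negative rate [c] is allowed: nonnegativity of [E] then forces [E] to
   vanish identically. *)
Lemma geometric_decay (R : realFieldType) (E : nat -> R) (c : R) :
  (forall t, 0 <= E t) -> (forall t, E t.+1 <= c * E t) ->
  forall t, E t <= c ^+ t * E 0%N.
Proof.
move=> E_ge0 Estep; have [c_ge0|c_lt0] := leP 0 c.
  elim=> [|t IHt]; first by rewrite expr0 mul1r.
  by rewrite exprS -mulrA (le_trans (Estep t)) // ler_wpM2l.
have E0 t : E t = 0.
  apply/le_anti; rewrite E_ge0 andbT.
  by rewrite -(nmulr_rge0 _ c_lt0) (le_trans (E_ge0 t.+1)).
by move=> t; rewrite !E0 mulr0.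
Qed.

Theorem theorem7 (R : realType) (n : nat) (hn : (2 <= n)%N)
  (P : 'M[R]_n) (pi : 'rV[R]_n) (mu gamma beta : R)
  (x0 : 'rV[R]_n) (i : nat -> 'I_n)
  (hP : row_stochastic P)
  (hirr : irreducible P)
  (hpi : stationary P pi)
  (hmu : poincare_constant P pi mu)
  (hnr : nearly_reversible P pi mu)
  (hgamma : gamma = gamma_inf P pi mu \/ gamma = gamma_2 P pi mu)
  (hbeta : 0 < beta <= 1)
  (hgb : gamma <= Num.sqrt beta)
  (hgood : forall t : nat, good_coordinate P pi beta (rlgl_y P pi x0 i t) (i t))
  (heta : eta_inf P pi mu ^+ 2 < beta_tilde beta gamma) :
  1 - beta_tilde beta gamma * mu + kappa P pi ^+ 2 / mu < 1 /\
  forall t : nat,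
    dirichlet P pi (rlgl_y P pi x0 i t) <=
      (1 - beta_tilde beta gamma * mu + kappa P pi ^+ 2 / mu) ^+ t
        * dirichlet P pi (rlgl_y P pi x0 i 0).
Proof.
have mu_gt0 := poincare_constant_gt0 hP hpi hmu.
have [pi_gt0 _ _] := hpi; have [beta_gt0 _] := andP hbeta.
have [eta [eta01 kLe gammaE]] := gamma_eta (ltnW hn) mu_gt0 hnr hgamma.
split.
  (* Multiplied by [mu], the hypothesis on [eta_inf] says that the gain [beta_tilde * mu] exceeds
     the loss [kappa^2 / mu]. *)
  move: heta; rewrite /eta_inf expr_div_n ltr_pdivrMr ?exprn_gt0 // => heta'.
  have : kappa P pi ^+ 2 / mu < beta_tilde beta gamma * mu.
    by rewrite ltr_pdivrMr // -mulrA -expr2.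
  lra.
apply: geometric_decay => t.
  by rewrite mulr_ge0 ?invr_ge0 ?ler0n // laplacian_form_ge0.
rewrite rlgl_yS // gammaE; apply: dirichlet_step (hgood t) => //.
  exact: ltW.
by rewrite -gammaE.
Qed.
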